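(* Let $F_1,F$ be two square-integrable graph root distributions on $\mathcal K$, with corresponding graphons $W_1,W$ obtained by inverse transform sampling. Then $$\delta_\square(W_1,W)\le\left(\mathbb E_{Z\sim F_1}\|Z\|+\mathbb E_{Z\sim F}\|Z\|\right)d_{\rm ow}(F_1,F).$$ As a consequence, if $(F_N:N\ge1)$ are square-integrable graph root distributions on $\mathcal K$ with corresponding graphons $(W_N:N\ge1)$, then $$d_{\rm ow}(F_N,F)\to0\ \Rightarrow\ \delta_\square(W_N,W)\to0.$$
   Context: Krein space: $\mathcal H_+=\mathcal H_-=\{x\in\mathbb R^\infty:\sum_j x_j^2<\infty\}$ with the usual inner product, and $\mathcal K=\mathcal H_+\ominus\mathcal H_-$ is the set of pairs $(x,y)$, $x\in\mathcal H_+$, $y\in\mathcal H_-$, with indefinite inner product $\langle(x,y),(x',y')\rangle_{\mathcal K}=\langle x,x'\rangle_{\mathcal H_+}-\langle y,y'\rangle_{\mathcal H_-}$, norm $\|(x,y)\|=(\|x\|^2+\|y\|^2)^{1/2}$, and its Borel $\sigma$-field. Graph root distribution (GRD): a Borel probability measure $F$ on $\mathcal K$ such that $\mathbb P(\langle Z_1,Z_2\rangle_{\mathcal K}\in[0,1])=1$ for independent $Z_1,Z_2\sim F$; square-integrable means $\mathbb E_{Z\sim F}\|Z\|^2<\infty$. Inverse transform sampling mapping (ITS) of $F$: a measurable $Z:[0,1]\to\mathcal K$ such that $Z(s)\sim F$ when $s$ is uniform on $[0,1]$. A graphon corresponding to $F$ is $W(s,s')=\langle Z(s),Z(s')\rangle_{\mathcal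 K}$ for an ITS $Z$ of $F$; it is symmetric and takes values in $[0,1]$ almost everywhere. Cut-distance: $\delta_\square(W_1,W_2)=\inf_{h_1,h_2}\sup_{S,S'\subseteq[0,1]}\left|\int_{S\times S'}[W_1(h_1(s),h_1(s'))-W_2(h_2(s),h_2(s'))]\,ds\,ds'\right|$, where $h_1,h_2$ range over Lebesgue-measure-preserving maps $[0,1]\to[0,1]$ and $S,S'$ over measurable sets. Orthogonal Wasserstein distance: $d_{\rm ow}(F_1,F_2)=\inf_{\nu\in\mathcal V(F_1,F_2)}\inf_{Q_+,Q_-}\mathbb E_{(Z_1,Z_2)\sim\nu}\|Z_1-(Q_+\oplus Q_-)Z_2\|$, where $\mathcal V(F_1,F_2)$ is the set of all distributions on $\mathcal K\times\mathcal K$ with marginals $F_1$ and $F_2$, $Q_+$ and $Q_-$ range over all orthogonal transforms on $\mathcal H_+$ and $\mathcal H_-$ respectively, and $(Q_+\oplus Q_-)(x,y)=(Q_+x,Q_-y)$. *)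

(* Defs.v *)
From HB Require Import structures.
From mathcomp Require Import all_boot all_order all_algebra.
From mathcomp Require Import all_classical all_reals all_analysis.
From mathcomp Require Import ring lra.

Set Implicit Arguments.
Unset Strict Implicit.
Unset Printing Implicit Defensive.

Import Order.TTheory GRing.Theory Num.Theory.
Import numFieldNormedType.Exports.

Local Open Scope classical_set_scope.
Local Open Scope ring_scope.

Section ell2_def.
Variable R : realType.

Definition square_summable : {pred nat -> R} :=
  [pred x : nat -> R | `[< cvgn (series (fun j => x j ^+ 2)) >]].

Lemma square_summable_closed : submod_closed square_summable.
Proof.
split => [|a x y /asboolP cx /asboolP cy]; apply/asboolP.
  rewrite [X in series X](_ : _ = fun=> 0); last first.
    by apply/funext => j; rewrite expr0n.
  rewrite [series _](_ : _ = fun=> 0); first exact: is_cvg_cst.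
  by apply/funext => n; rewrite /series/= big1.
apply: (@series_le_cvg _ _
    ((2 * a ^+ 2) *: (fun j => x j ^+ 2) + 2 *: (fun j => y j ^+ 2))).
- by move=> n; exact: sqr_ge0.
- move=> n; rewrite !fctE; apply: addr_ge0; apply: mulr_ge0 => //.
  - by rewrite mulr_ge0 ?sqr_ge0.
  - exact: sqr_ge0.
  - exact: sqr_ge0.
- move=> n; rewrite !fctE /GRing.scale/=.
  have := sqr_ge0 (a * x n - y n); nra.
- by apply: is_cvg_seriesD; exact: is_cvg_seriesZ.
Qed.

HB.instance Definition _ :=
  GRing.isSubmodClosed.Build R (nat -> R) square_summable
    square_summable_closed.

Record ell2 := Ell2 {
  ell2_seq :> nat -> R ;
  ell2_seqP : ell2_seq \in square_summable }.

HB.instance Definition _ := [isSub for ell2_seq].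
HB.instance Definition _ := [Choice of ell2 by <:].
HB.instance Definition _ := [SubChoice_isSubLmodule of ell2 by <:].

Definition ell2_inner (x y : ell2) : R := limn (series (fun j => x j * y j)).

Definition ell2_norm (x : ell2) : R := Num.sqrt (ell2_inner x x).

End ell2_def.

Section ell2_theory.
Variable R : realType.
Implicit Types (x y z : ell2 R) (a : R).

Lemma is_cvg_ell2_sqr x : cvgn (series (fun j => x j ^+ 2)).
Proof. by apply/asboolP; exact: (ell2_seqP x). Qed.

Lemma is_cvg_ell2_inner x y : cvgn (series (fun j => x j * y j)).
Proof.
apply: normed_cvg; apply: (@series_le_cvg _ _
    ((fun j => x j ^+ 2) + (fun j => y j ^+ 2))) => [n|n|n|].
- exact: normr_ge0.
- by rewrite !fctE addr_ge0 ?sqr_ge0.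
- rewrite !fctE /= ler_norml; apply/andP.
  by have := sqr_ge0 (x n - y n); have := sqr_ge0 (x n + y n); split; nra.
- by apply: is_cvg_seriesD; exact: is_cvg_ell2_sqr.
Qed.

Lemma ell2_innerC x y : ell2_inner x y = ell2_inner y x.
Proof.
by rewrite /ell2_inner; congr (limn (series _)); apply/funext => j; exact: mulrC.
Qed.

Lemma ell2_innerDl x y z :
  ell2_inner (x + y) z = ell2_inner x z + ell2_inner y z.
Proof.
rewrite /ell2_inner -lim_seriesD; [|exact: is_cvg_ell2_inner..].
by congr (limn (series _)); apply/funext => j; exact: mulrDl.
Qed.

Lemma ell2_innerZl a x y : ell2_inner (a *: x) y = a * ell2_inner x y.
Proof.
transitivity (a *: ell2_inner x y) => //.
rewrite /ell2_inner -lim_seriesZ; last exact: is_cvg_ell2_inner.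
by congr (limn (series _)); apply/funext => j; rewrite fctE /GRing.scale/= mulrA.
Qed.

Lemma ell2_inner_ge0 x : 0 <= ell2_inner x x.
Proof.
apply: limr_ge; first exact: is_cvg_ell2_inner.
by near=> n; apply: sumr_ge0 => i _; rewrite -expr2 sqr_ge0.
Unshelve. all: by end_near. Qed.

Lemma ell2_inner_eq0 x : ell2_inner x x = 0 -> x = 0.
Proof.
move=> x0; apply/val_inj/funext => j /=; apply/eqP.
rewrite -[_ == _]/(x j == 0) -sqrf_eq0; apply/eqP/le_anti.
rewrite sqr_ge0 andbT -x0 /ell2_inner.
apply: limr_ge; first exact: is_cvg_ell2_inner.
near=> n.
have jn : (j < n)%N by near: n; exact: nbhs_infty_gt.
rewrite /series/= big_mkord (bigD1 (Ordinal jn))//= expr2 lerDl.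
by apply: sumr_ge0 => i _; rewrite -expr2 sqr_ge0.
Unshelve. all: by end_near. Qed.

Lemma ell2_normE x : ell2_norm x ^+ 2 = ell2_inner x x.
Proof. by rewrite sqr_sqrtr// ell2_inner_ge0. Qed.

End ell2_theory.

(* An alias of the product, so that it can carry the Hilbert norm
   (|x|^2 + |y|^2)^(1/2) rather than the max norm of product spaces. *)
Definition krein (R : realType) : Type := (ell2 R * ell2 R)%type.

HB.instance Definition _ (R : realType) := GRing.Lmodule.on (krein R).

Definition krein_inner (R : realType) (z w : krein R) : R :=
  ell2_inner z.1 w.1 - ell2_inner z.2 w.2.

Definition krein_norm (R : realType) (z : krein R) : R :=
  Num.sqrt (ell2_norm z.1 ^+ 2 + ell2_norm z.2 ^+ 2).

Section krein_normed.
Variable R : realType.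
Implicit Types (z w : krein R) (a : R).

Let dot z w := ell2_inner z.1 w.1 + ell2_inner z.2 w.2.

Let krein_normE z : krein_norm z = Num.sqrt (dot z z).
Proof. by rewrite /krein_norm !ell2_normE. Qed.

Let dotC z w : dot z w = dot w z.
Proof. by rewrite /dot ell2_innerC [X in _ + X]ell2_innerC. Qed.

Let dotDl z w v : dot (z + w) v = dot z v + dot w v.
Proof. by rewrite /dot !ell2_innerDl addrACA. Qed.

Let dotZl a z w : dot (a *: z) w = a * dot z w.
Proof. by rewrite /dot !ell2_innerZl mulrDr. Qed.

Let dot_ge0 z : 0 <= dot z z.
Proof. by rewrite addr_ge0 ?ell2_inner_ge0. Qed.

Let cauchy_schwarz z w : dot z w ^+ 2 <= dot z z * dot w w.
Proof.
have expand a b : dot (a *: z + b *: w) (a *: z + b *: w) =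
    a ^+ 2 * dot z z + 2 * a * b * dot z w + b ^+ 2 * dot w w.
  rewrite dotDl !dotZl [dot z (_ + _)]dotC [dot w (_ + _)]dotC !dotDl !dotZl.
  rewrite [dot w z]dotC; ring.
have := dot_ge0 (dot w w *: z + (- dot z w) *: w); rewrite expand => H.
have := dot_ge0 ((- dot z w) *: z + dot z z *: w); rewrite expand => H'.
have := dot_ge0 (1 *: z + (- dot z w) *: w); rewrite expand => H''.
have := dot_ge0 z; have := dot_ge0 w; rewrite le_eqVlt.
by case/predU1P => [w0 _|w0 z0]; [rewrite -w0 in H'' H' H *|]; nra.
Qed.

Lemma ler_krein_normD z w : krein_norm (z + w) <= krein_norm z + krein_norm w.
Proof.
rewrite !krein_normE.
rewrite -(@ler_pXn2r _ 2)// ?nnegrE ?addr_ge0 ?sqrtr_ge0//.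
rewrite sqrrD !sqr_sqrtr ?dot_ge0// dotDl [dot z (_ + _)]dotC.
rewrite [dot w (_ + _)]dotC !dotDl [dot w z]dotC.
have : dot z w <= Num.sqrt (dot z z) * Num.sqrt (dot w w).
  rewrite -sqrtrM ?dot_ge0//; apply: le_trans (ler_norm _) _.
  by rewrite -sqrtr_sqr ler_wsqrtr// cauchy_schwarz.
rewrite mulr2n; lra.
Qed.

Lemma krein_normZ a z : krein_norm (a *: z) = `|a| * krein_norm z.
Proof.
rewrite !krein_normE dotZl dotC dotZl mulrA -expr2 sqrtrM ?sqr_ge0//.
by rewrite sqrtr_sqr.
Qed.

Lemma krein_norm_eq0 z : krein_norm z = 0 -> z = 0.
Proof.
rewrite krein_normE => /eqP; rewrite sqrtr_eq0 => z0.
have [] := (ell2_inner_ge0 z.1, ell2_inner_ge0 z.2).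
rewrite /dot in z0 => z1 z2.
by case: z z0 z1 z2 => x y /= *; congr pair; apply: ell2_inner_eq0; lra.
Qed.

HB.instance Definition _ := Lmodule_isNormed.Build R (krein R)
  ler_krein_normD krein_normZ krein_norm_eq0.

HB.instance Definition _ :=
  @isMeasurable.Build (sigma_display (@open (krein R))) (krein R)
    <<s @open (krein R) >> (@sigma_algebra0 _ setT _) (@sigma_algebraC _ _)
    (@sigma_algebra_bigcup _ setT _).

End krein_normed.

Section graph_root_distributions.
Variable R : realType.
Implicit Types (F : probability (krein R) R) (W : R -> R -> R).

Local Notation mu := (@lebesgue_measure R).
Local Notation I01 := (`[(0 : R), (1 : R)]%classic).

(* The law of an independent pair (Z1, Z2) with Z1, Z2 ~ F is F \x F. *)
Definition graph_root_distribution F : Prop :=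
  (F \x F)%E [set p | krein_inner p.1 p.2 \in `[0, 1]] = 1%E.

Definition square_integrable F : Prop :=
  ('E_F[fun z : krein R => (`|z| ^+ 2)%R] < +oo)%E.

(* Functions on the unit interval are represented by functions on R of which
   only the restriction to `[0, 1] is constrained and used. *)
Definition inverse_transform_sampling F (Z : R -> krein R) : Prop :=
  measurable_fun I01 Z /\
  forall A, measurable A -> mu (I01 `&` Z @^-1` A) = F A.

Definition graphon_of F W : Prop :=
  exists2 Z, inverse_transform_sampling F Z &
    forall s t, I01 s -> I01 t ->
      W s t = krein_inner (Z s) (Z t).

Definition measure_preserving01 (h : R -> R) : Prop :=
  [/\ measurable_fun I01 h,
      forall s, I01 s -> I01 (h s) &
      forall A, measurable A -> A `<=` I01 ->
        mu (I01 `&` h @^-1` A) = mu A].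

Definition cut_norm (U : R -> R -> R) : \bar R :=
  ereal_sup [set `| \int[mu \x mu]_(p in S.1 `*` S.2) (U p.1 p.2)%:E |%E
    | S in [set S : set R * set R |
        [/\ measurable S.1, S.1 `<=` I01,
            measurable S.2 & S.2 `<=` I01]]].

Definition cut_distance W1 W2 : \bar R :=
  ereal_inf [set cut_norm
      (fun s t => W1 (h.1 s) (h.1 t) - W2 (h.2 s) (h.2 t))
    | h in [set h : (R -> R) * (R -> R) |
        measure_preserving01 h.1 /\ measure_preserving01 h.2]].

(* krein R is separable, so the product sigma-algebra carried by
   krein R * krein R is also the Borel sigma-algebra of the product. *)
Definition couplings F1 F2 : set (probability (krein R * krein R)%type R) :=
  [set nu | (forall A, measurable A -> nu (fst @^-1` A) = F1 A) /\
            (forall A, measurable A -> nu (snd @^-1` A) = F2 A)].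

(* In infinite dimension an isometry need not be onto; an orthogonal
   transform is, by definition, invertible. *)
Definition orthogonal_transform (Q : {linear ell2 R -> ell2 R}) : Prop :=
  (forall x y, ell2_inner (Q x) (Q y) = ell2_inner x y) /\
  (forall y, exists x, Q x = y).

Definition oplus (Qp Qm : {linear ell2 R -> ell2 R}) (z : krein R) : krein R :=
  (Qp z.1, Qm z.2).

Definition orthogonal_wasserstein F1 F2 : \bar R :=
  ereal_inf [set
    ereal_inf [set ('E_nu[fun p => `|p.1 - oplus Q.1 Q.2 p.2|%R])%E
      | Q in [set Q : {linear ell2 R -> ell2 R} * {linear ell2 R -> ell2 R} |
          orthogonal_transform Q.1 /\ orthogonal_transform Q.2]]
    | nu in couplings F1 F2].

End graph_root_distributions.

(* Main.v *)
(* Any coupling nu of F1 and F is almost realized on [0, 1]: there are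
   measure-preserving h1, h2 such that the pair (Z1 o h1, Z o h2) costs at most
   4 e more than nu.  To find them, quantize K by a countable family of cells of
   radius e, pick a random pair of cells (i, j) with the law given by nu
   together with an independent uniform variable u, both as functions of one
   uniform s (quantile transform), and let h1 s be the u-quantile of Lebesgue
   measure conditioned on { Z1 in cell i }, h2 s that of Lebesgue measure
   conditioned on { Z in cell j }.
   For X = Z1 o h1 and Y = (Q+ (+) Q-) o Z o h2, the identity
   <X s, X t> - <Y s, Y t> = <X s - Y s, X t> + <Y s, X t - Y t>
   and Cauchy-Schwarz bound the cut norm by
   (E |X| + E |Y|) E |X - Y|; let e tend to 0.  For the convergence statement,
   E_{F_N} |Z| <= d_ow(F_N, F) + E_F |Z| keeps the first factor bounded. *)

Require Import Defs.
From HB Require Import structures.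
From mathcomp Require Import all_boot all_order all_algebra.
From mathcomp Require Import all_classical all_reals all_analysis.
From mathcomp Require Import measurable_realfun ring lra.

Import Order.TTheory GRing.Theory Num.Theory.
Import numFieldNormedType.Exports.

Set Implicit Arguments.
Unset Strict Implicit.
Unset Printing Implicit Defensive.

Local Open Scope classical_set_scope.
Local Open Scope ring_scope.

(** * Sampling from a uniform variable *)

Lemma measurable_preimageT d1 d2 (T1 : measurableType d1)
    (T2 : measurableType d2) (f : T1 -> T2) (A : set T2) :
  measurable_fun setT f -> measurable A -> measurable (f @^-1` A).
Proof. by move=> mf mA; rewrite -[X in measurable X]setTI; exact: mf. Qed.

Lemma measurable_oo01 (R : realType) :
  measurable (`](0 : R), (1 : R)[%classic : set (measurableTypeR R)).
Proof. exact: measurable_itv. Qed.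

(* The endpoints are left out because [quantile] below is meaningful only for
   0 < u < 1. *)
Definition uniform01 (R : realType) : set (measurableTypeR R) -> \bar R :=
  mrestr lebesgue_measure (@measurable_oo01 R).

Section uniform01.
Variable R : realType.
Local Notation oo01 := (`](0 : R), (1 : R)[%classic).
Local Notation cc01 := (`[(0 : R), (1 : R)]%classic).

HB.instance Definition _ := Measure.on (@uniform01 R).

Lemma uniform01_setT : @uniform01 R setT = 1%E.
Proof.
by rewrite /uniform01 /mrestr setTI lebesgue_measure_itv/= lte_fin ltr01 sube0.
Qed.

HB.instance Definition _ :=
  Measure_isProbability.Build _ _ _ (@uniform01 R) uniform01_setT.

Lemma uniform01_eq (A B : set R) :
  (forall u, 0 < u < 1 -> A u <-> B u) -> uniform01 A = uniform01 B.
Proof.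
move=> AB; congr (lebesgue_measure _).
apply/seteqP; split => u [] /[swap]; rewrite /= in_itv/= => u01.
  by move/(AB _ u01).
by move/(AB _ u01).
Qed.

(** The two intervals differ by the null set {0, 1}, and both sides are compared after adding it.
    Only the trace of [A] on [0, 1] is assumed measurable because a sampling map is constrained on
    [0, 1] alone. *)
Lemma lebesgue_measure_cc01 (A : set (measurableTypeR R)) :
  measurable (cc01 `&` A) -> lebesgue_measure (cc01 `&` A) = uniform01 A.
Proof.
move=> mA; have oocc : oo01 `<=` cc01 by exact: subset_itv_oo_cc.
have E : A `&` oo01 = (cc01 `&` A) `&` oo01.
  by rewrite setIAC (setIidr oocc) setIC.
have mA' : measurable (A `&` oo01 : set (measurableTypeR R)).
  by rewrite E; apply: measurableI => //; exact: measurable_oo01.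
have c01 : countable [set (0 : R); 1] by exact/finite_set_countable.
have m01 : measurable ([set 0; 1] : set (measurableTypeR R)).
  exact: countable_measurable.
have l01 : lebesgue_measure ([set 0; 1] : set (measurableTypeR R)) = 0%E.
  exact: countable_lebesgue_measure0.
pose mu : {measure set (measurableTypeR R) -> \bar R} := @lebesgue_measure R.
rewrite /uniform01 /mrestr -[LHS](@measureU0 _ _ _ mu _ _ mA m01 l01).
rewrite -[RHS](@measureU0 _ _ _ mu _ _ mA' m01 l01).
congr (lebesgue_measure _); rewrite E.
apply/seteqP; split => x /=; rewrite !in_itv/=; last first.
  by move=> [[[? ?] ?]|?]; [left|right].
move=> [[/andP[]]|]; last by right.
rewrite le_eqVlt => /orP[/eqP <-|x0]; first by move=> _ _; right; left.
rewrite le_eqVlt => /orP[/eqP ->|x1]; first by move=> _; right; right.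
by move=> Ax; left; rewrite x0 x1 !orbT.
Qed.

End uniform01.

Definition mfun_of d1 d2 (T1 : measurableType d1) (T2 : measurableType d2)
    (f : T1 -> T2) (mf : measurable_fun setT f) : {mfun T1 >-> T2} :=
  HB.pack f (isMeasurableFun.Build _ _ _ _ f mf).

(** * Quantile transform of a law on the line *)

Section quantile.
Variables (R : realType) (P : probability (measurableTypeR R) R).
Local Open Scope measure_display_scope.
Local Notation oo01 := (`](0 : R), (1 : R)[%classic).

Let G (x : R) : R := fine (P `]-oo, x]%classic).

Let GE x : P `]-oo, x]%classic = (G x)%:E.
Proof. by rewrite /G fineK// fin_num_measure. Qed.

Let G_nd : {homo G : x y / x <= y}.
Proof.
move=> x y xy; rewrite -lee_fin -!GE le_measure ?inE//.
exact: subitvPr.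
Qed.

(** [P] is the law of the identity, so the properties of distribution functions of random variables
    apply to [G]. *)
Let idR : measurableTypeR R -> R := idfun.

#[local] HB.instance Definition _ :=
  @isMeasurableFun.Build _ _ _ _ idR (@measurable_id _ _ setT).

Let cdfE x : cdf (idR : {RV P >-> R}) x = (G x)%:E.
Proof. by rewrite -GE. Qed.

(** The generalized inverse of the distribution function [G]. For 0 < u < 1 the set is nonempty and
    bounded below, so the infimum is genuine. *)
Definition quantile (u : R) : R := inf [set x | u <= G x].

Let exists_G_lt u : 0 < u -> exists y, G y < u.
Proof.
move=> u0; have := cvg_cdfNy0 (idR : {RV P >-> R}).
move=> /(_ [set y | (y < u%:E)%E]) H.
have : \forall x \near -oo, (cdf (idR : {RV P >-> R}) x < u%:E)%E.
  by apply: H; exact: nbhs_open_ereal_lt.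
move=> [M [_ /(_ (M - 1))]]; rewrite ltrBlDr ltrDl ltr01 => /(_ isT).
by rewrite /= cdfE lte_fin => ?; exists (M - 1).
Qed.

Let exists_G_gt u : u < 1 -> exists y, u <= G y.
Proof.
move=> u1; have := cvg_cdfy1 (idR : {RV P >-> R}).
move=> /(_ [set y | (u%:E < y)%E]) H.
have : \forall x \near +oo, (u%:E < cdf (idR : {RV P >-> R}) x)%E.
  by apply: H; exact: nbhs_open_ereal_gt.
move=> [M [_ /(_ (M + 1))]]; rewrite ltrDl ltr01 => /(_ isT).
by rewrite /= cdfE lte_fin => ?; exists (M + 1); exact: ltW.
Qed.

Lemma quantile_le u x : 0 < u -> u < 1 -> (quantile u <= x) = (u <= G x).
Proof.
move=> u0 u1.
have lbS : has_lbound [set x | u <= G x].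
  have [y Gy] := exists_G_lt u0; exists y => z /= uz.
  rewrite leNgt; apply/negP => zy; move: (lt_le_trans Gy uz).
  by rewrite ltNge G_nd// ltW.
apply/idP/idP => [qx|ux]; last exact: ge_inf.
(* Right continuity of [G] gives y > x with [G y < u]. By monotonicity no point of the set lies
   below y, against [quantile u <= x < y]. *)
rewrite leNgt; apply/negP => Gxu.
have := @cdf_right_continuous _ _ _ _ (idR : {RV P >-> R}) x.
move=> /(_ [set y | (y < u%:E)%E]) H.
have : \forall y \near x^'+, (cdf (idR : {RV P >-> R}) y < u%:E)%E.
  by apply: H; rewrite cdfE; exact: nbhs_open_ereal_lt.
move=> nH.
have [y [xy Gyu]] : exists y, x < y /\ G y < u.
  have := @filter_ex _ (x^'+) _ _ (filterI nH (nbhs_right_gt x)).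
  by move=> [y []]; rewrite /= cdfE lte_fin; exists y.
have [z /= uz zy] := inf_lt (exists_G_gt u1) (le_lt_trans qx xy).
by have := le_lt_trans uz (le_lt_trans (G_nd (ltW zy)) Gyu); rewrite ltxx.
Qed.

Let quantile_gt x : oo01 `&` quantile @^-1` `]x, +oo[%classic =
  oo01 `&` `]G x, +oo[%classic.
Proof.
have E u : 0 < u -> u < 1 -> (x < quantile u) = (G x < u).
  by move=> u0 u1; rewrite ltNge quantile_le// -ltNge.
apply/seteqP; split => u [] /=; rewrite !in_itv/= !andbT => /andP[u0 u1].
  by rewrite E// => ?; split => //; rewrite u0 u1.
by move=> ?; rewrite E//; split => //; rewrite u0 u1.
Qed.

Let m01 : measurable (oo01 : set (measurableTypeR R)).
Proof. exact: measurable_itv. Qed.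

Lemma measurable_quantile : measurable_fun oo01 quantile.
Proof.
apply: (measurability _ (RGenOInfty.measurableE R)) => _ [_ [x ->] <-].
by rewrite quantile_gt; apply: measurableI; exact: measurable_itv.
Qed.

(** Inverse transform sampling on the line: the rays []x, +oo[] form a generating class stable under
    intersection, and on each of them both laws equal 1 - [G x] by [quantile_gt]. *)
Lemma uniform01_quantile : exists2 q : measurableTypeR R -> measurableTypeR R,
  measurable_fun setT q & forall A, measurable A -> uniform01 (q @^-1` A) = P A.
Proof.
pose q : measurableTypeR R -> measurableTypeR R := quantile \_ oo01.
have mq : measurable_fun setT q.
  apply/(measurable_restrictT _ _).1; first exact: measurable_oo01.
  exact: measurable_quantile.
exists q => // A mA.
have qE B : uniform01 (q @^-1` B) =
    lebesgue_measure (oo01 `&` quantile @^-1` B).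
  congr (lebesgue_measure _).
  apply/seteqP; split => u [] /=; rewrite /q patchE.
    by move=> + u01; rewrite mem_set.
  by move=> u01; rewrite mem_set.
pose rays := [set B : set R | exists x, B = `]x, +oo[%classic].
pose m : probability (measurableTypeR R) R :=
  distribution (@uniform01 R) (mfun_of mq).
rewrite -[LHS]/(m A).
have mrays : @measurable _ (measurableTypeR R) = <<s rays >>.
  exact: (RGenOInfty.measurableE R).
apply: (@measure_unique _ R (measurableTypeR R) rays
  (fun n => `](- n%:R), +oo[%classic) mrays _ _ _ m P) => //.
- move=> _ _ [x ->] [y ->]; exists (Num.max x y).
  apply/seteqP; split => z /=; rewrite !in_itv/= !andbT gt_max.
    by move=> [-> ->].
  by move=> /andP[].
- by move=> n; exists (- n%:R).
- apply/seteqP; split => // z _; exists (Num.truncn `|z|).+1 => //=.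
  rewrite in_itv/= andbT ltrNl (le_lt_trans (ler_norm _))// normrN.
  exact: Num.Theory.truncnS_gt.
- move=> _ [x ->]; rewrite [LHS]qE quantile_gt.
  have G0 : 0 <= G x by rewrite fine_ge0.
  have G1 : G x <= 1 by rewrite -lee_fin -GE probability_le1.
  have := @probability_setC _ _ _ P `]-oo, x]%classic (measurable_itv _).
  rewrite setCitvl GE => PE; rewrite [RHS]PE.
  rewrite (_ : _ `&` _ = `](G x), 1[%classic).
    rewrite lebesgue_measure_itv/= lte_fin; case: ltP => // ?.
    by rewrite (_ : G x = 1) ?subee//; apply/le_anti/andP.
  apply/seteqP; split => z /=; rewrite !in_itv/= !andbT.
    by move=> [/andP[_ ->] ->].
  by move=> /andP[Gz ->]; rewrite Gz (le_lt_trans G0 Gz).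
- by move=> n; rewrite (le_lt_trans (probability_le1 _ _)) ?ltry//;
    exact: measurable_itv.
Qed.

End quantile.

Lemma measurable_fun_nat_valued d (T : measurableType d) (f : T -> nat) :
  (forall n, measurable (f @^-1` [set n])) -> measurable_fun setT f.
Proof.
move=> mf _ A _; rewrite setTI (_ : f @^-1` A = \bigcup_(n in A) f @^-1` [set n]).
  by apply: bigcup_measurable => n _; exact: mf.
by apply/seteqP; split => [x Ax|x [n An /= ->//]]; exists (f x).
Qed.

Lemma measurable_nat_prod d (T : measurableType d) (A : set (nat * T)) :
  (forall n, measurable [set y | A (n, y)]) -> measurable A.
Proof.
move=> mA.
rewrite (_ : A = \bigcup_n ([set n] `*` [set y | A (n, y)])); last first.
  apply/seteqP; split => [[n y] Any|[n y] [m _ [/= -> //]]].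
  by exists n.
by apply: bigcup_measurable => n _; exact: measurableX.
Qed.

(** The right-hand side involves only the law of [c], so integrals over different spaces can be
    compared through indices with equal laws. *)
Lemma ge0_integral_nat_valued d (T : measurableType d) (R : realType)
    (m : {measure set T -> \bar R}) (c : T -> nat) (phi : nat -> \bar R) :
  measurable_fun setT c -> (forall n, 0 <= phi n)%E ->
  (\int[m]_x phi (c x) = \sum_(n <oo) phi n * m (c @^-1` [set n]))%E.
Proof.
move=> mc phi0; have mB n : measurable (c @^-1` [set n]).
  exact: measurable_preimageT.
have UB : \bigcup_n (c @^-1` [set n]) = setT.
  by apply/seteqP; split => // x _; exists (c x).
rewrite -UB ge0_integral_bigcup//; last 2 first.
- by rewrite UB; exact: (measurableT_comp (f := phi)).
- apply/trivIsetP => i j _ _ /eqP ij; apply/seteqP.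
  by split => // x [/= cxi cxj]; case: ij; rewrite -cxi -cxj.
apply: eq_eseriesr => n _.
rewrite (eq_integral (cst (phi n))); last by move=> x; rewrite inE /= => ->.
by rewrite integral_cst.
Qed.

(* The pair (n, u) is encoded as the real number n + u, of which n is the integer
   part since 0 < u < 1 almost surely. *)
Lemma uniform01_nat_prod (R : realType) (P : probability nat R) :
  exists2 T : measurableTypeR R -> nat * measurableTypeR R,
    measurable_fun setT T &
    forall C, measurable C ->
      uniform01 (T @^-1` C) = (P \x @uniform01 R)%E C.
Proof.
pose e (p : nat * measurableTypeR R) : measurableTypeR R := p.1%:R + p.2.
pose natR (n : nat) : measurableTypeR R := n%:R.
have mnatR : measurable_fun setT natR by [].
have me : measurable_fun setT e.
  apply: (measurable_funD (f := natR \o fst) (g := snd)) => //.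
  exact: (measurableT_comp mnatR).
have [q mq qE] := uniform01_quantile (distribution (P \x @uniform01 R)%E (mfun_of me)).
pose fl (x : measurableTypeR R) : nat := Num.truncn x.
have mfl : measurable_fun setT fl.
  apply: measurable_fun_nat_valued => -[|n].
    rewrite (_ : _ @^-1` _ = `]-oo, 1[%classic); first exact: measurable_itv.
    apply/seteqP; split => x /=; rewrite in_itv/= /fl.
      by move=> x0; rewrite -(truncn_le_nat x 0) x0.
    by rewrite -(truncn_le_nat x 0) leqn0 => /eqP.
  rewrite (_ : _ @^-1` _ = `[n.+1%:R, n.+2%:R[%classic); first exact: measurable_itv.
  apply/seteqP; split => x /=; rewrite in_itv/= /fl -truncn_gt_nat -truncn_le_nat.
    by move=> ->; rewrite !leqnn.
  by rewrite andbC -eqn_leq => /eqP.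
pose dec x := (fl x, x - (fl x)%:R).
have mdec : measurable_fun setT dec.
  apply: measurable_fun_pair => //.
  apply: (measurable_funB (f := id) (g := natR \o fl)) => //.
  exact: (measurableT_comp mnatR).
exists (dec \o q); first exact: measurableT_comp.
move=> C mC.
rewrite comp_preimage qE; last exact: measurable_preimageT mdec mC.
rewrite /distribution /pushforward /= /product_measure1.
apply: eq_integral => n _ /=; apply: uniform01_eq => u /andP[u0 u1].
rewrite /xsection /= !inE /= /dec /e /=.
have -> : fl (n%:R + u) = n.
  by apply: truncn_def; rewrite -natr1 lerDl ltrD2l u1 ltW.
by rewrite addrAC subrr add0r.
Qed.

(** The multiplication rule for conditional probability. Written as a product it survives [P B = 0],
    where both sides vanish whatever default [mnormalize] returns. *)
Lemma mnormalize_mrestrE d (T : measurableType d) (R : realType)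
    (P : probability T R) (B : set T) (mB : measurable B) (A : set T) :
  measurable A -> (P B * mnormalize (mrestr P mB) P A = P (A `&` B))%E.
Proof.
move=> mA; rewrite /mnormalize/= /mrestr setTI.
have [P0|P0 /=] := eqVneq (P B) 0%E.
  rewrite P0 mul0e; apply/esym/(@subset_measure0 _ _ _ P _ B) => //.
  exact: measurableI.
case: ifPn => [/eqP PB|_]; first by have := probability_le1 P mB; rewrite PB.
rewrite muleCA -[X in (_ * (X * _))%E]fineK ?fin_num_measure//.
by rewrite -EFinM divff ?mule1// fine_eq0// fin_num_measure.
Qed.

Section measure_preserving_lift.
Variables (R : realType) (P : probability nat R).
Local Notation mR := (measurableTypeR R).
Local Notation U := (@uniform01 R).
Variable T : mR -> nat * mR.
Hypothesis mT : measurable_fun setT T.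
Hypothesis TE : forall C, measurable C -> U (T @^-1` C) = (P \x U)%E C.
Variables (c : mR -> nat) (d : nat -> nat).
Hypothesis mc : measurable_fun setT c.
Hypothesis dE : forall n, P (d @^-1` [set n]) = U (c @^-1` [set n]).

Let B n := c @^-1` [set n].

Let mB n : measurable (B n).
Proof. exact: measurable_preimageT. Qed.

(** The uniform law conditioned on the cell [B n]; on a null cell it defaults to [U], but such a
    cell receives weight 0 below. *)
Let cond n : probability mR R := mnormalize (mrestr U (mB n)) U.

Let condE n A : measurable A -> (U (B n) * cond n A = U (A `&` B n))%E.
Proof. exact: mnormalize_mrestrE. Qed.

(** With [T s] = (n, u), take for [h s] the u-quantile of the law conditioned on the cell [B (d n)].
    The index [d n] has the law of [c], so mixing the conditional laws restores the uniform law,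
    while [h s] almost surely lands in the prescribed cell. *)
Lemma measure_preserving_lift : exists h : mR -> mR,
  [/\ measurable_fun setT h,
      forall A, measurable A -> U (h @^-1` A) = U A &
      U [set s | c (h s) != d (T s).1] = 0%E].
Proof.
have /choice[q qP] : forall n, exists q : mR -> mR, measurable_fun setT q /\
    forall A, measurable A -> U (q @^-1` A) = cond n A.
  by move=> n; have [q mq qE] := uniform01_quantile (cond n); exists q.
have mq n : measurable_fun setT (q n) by have [] := qP n.
have qE n A : measurable A -> U (q n @^-1` A) = cond n A by have [_] := qP n; apply.
have mq1 n A : measurable A -> measurable (q n @^-1` A).
  by move=> mA; exact: measurable_preimageT.
pose g (p : nat * mR) := q (d p.1) p.2.
have mg : measurable_fun setT g.
  move=> _ A mA; rewrite setTI; apply: measurable_nat_prod => n.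
  exact: (mq1 (d n) A).
have md : measurable_fun setT d by [].
have intd (phi : nat -> \bar R) : (forall n, 0 <= phi n)%E ->
    (\int[P]_n phi (d n) = \sum_(n <oo) phi n * U (B n))%E.
  move=> phi0; rewrite (ge0_integral_nat_valued P md phi0).
  by apply: eq_eseriesr => n _; congr (_ * _)%E; exact: dE.
exists (g \o T); split.
- exact: measurableT_comp.
- move=> A mA; rewrite comp_preimage TE; last first.
    exact: measurable_preimageT mg mA.
  rewrite /product_measure1.
  transitivity (\int[P]_n cond (d n) A)%E.
    apply: eq_integral => n _ /=; rewrite -qE//; congr (U _).
    by apply/seteqP; split => v; rewrite /xsection /= inE.
  (* Law of total probability over the partition of the line into the cells [B n]. *)
  rewrite (intd (fun n => cond n A))//.
  transitivity (\sum_(n <oo) U (A `&` B n))%E.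
    by apply: eq_eseriesr => n _; rewrite muleC condE.
  rewrite -measure_semi_bigcup; first last.
  - by apply: bigcup_measurable => n _; exact: measurableI.
  - apply/trivIsetP => i j _ _ /eqP ij; apply/seteqP.
    by split => // x [[_ /= cxi] [_ /= cxj]]; case: ij; rewrite -cxi -cxj.
  - by move=> n; exact: measurableI.
  rewrite -setI_bigcupr; congr (U _); apply/seteqP; split => [x []//|x Ax].
  by split => //; exists (c x).
- pose C := [set p : nat * mR | c (g p) != d p.1].
  have mC : measurable C.
    apply: measurable_nat_prod => n; rewrite /C /g /=.
    have -> : [set y | c (q (d n) y) != d n] = q (d n) @^-1` (~` B (d n)).
      by apply/seteqP; split => y /eqP.
    by apply: mq1; exact: measurableC.
  rewrite -[LHS]/(U (T @^-1` C)) TE// /product_measure1.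
  transitivity (\int[P]_n cond (d n) (~` B (d n)))%E.
    apply: eq_integral => n _ /=; rewrite -qE; last exact: measurableC.
    congr (U _).
    by apply/seteqP; split => v; rewrite /xsection /C /= inE/= => /eqP.
  (* Each term is the mass of [B n] outside itself. *)
  rewrite (intd (fun n => cond n (~` B n)))// eseries0// => n _ _.
  by rewrite muleC condE ?setICl ?measure0//; exact: measurableC.
Qed.

End measure_preserving_lift.

(** * Geometry and Borel structure of the Krein space *)

Section krein_geometry.
Variable R : realType.
Implicit Types z w v : krein R.
Local Notation K := (krein R).

Let innerDr (x y z : ell2 R) :
  ell2_inner x (y + z) = ell2_inner x y + ell2_inner x z.
Proof. by rewrite ell2_innerC ell2_innerDl ell2_innerC [in X in _ + X]ell2_innerC. Qed.

Let innerNr (x y : ell2 R) : ell2_inner x (- y) = - ell2_inner x y.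
Proof. by rewrite -scaleN1r ell2_innerC ell2_innerZl mulN1r ell2_innerC. Qed.

Lemma krein_normE z : `|z| ^+ 2 = ell2_inner z.1 z.1 + ell2_inner z.2 z.2.
Proof.
by rewrite [`|z|]/(krein_norm z) /krein_norm sqr_sqrtr ?addr_ge0 ?sqr_ge0// !ell2_normE.
Qed.

Lemma krein_innerDl z w v : krein_inner (z + w) v = krein_inner z v + krein_inner w v.
Proof. by rewrite /krein_inner !ell2_innerDl; ring. Qed.

Lemma krein_innerC z w : krein_inner z w = krein_inner w z.
Proof. by rewrite /krein_inner ell2_innerC [X in _ - X]ell2_innerC. Qed.

Lemma krein_innerNl z w : krein_inner (- z) w = - krein_inner z w.
Proof.
rewrite krein_innerC /krein_inner !innerNr (ell2_innerC w.1) (ell2_innerC w.2).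
ring.
Qed.

(** Changing the sign of the second component of [w] keeps its norm and turns the indefinite product
    into the Hilbert one. Cauchy-Schwarz is then read off the squared triangle inequality. *)
Let krein_inner_le z w : krein_inner z w <= `|z| * `|w|.
Proof.
pose w' : K := (w.1, - w.2).
have Nw' : `|w'| = `|w|.
  apply/eqP; rewrite -(@eqrXn2 _ 2)//; apply/eqP.
  rewrite !krein_normE /=; congr (_ + _).
  by rewrite innerNr ell2_innerC innerNr opprK.
have := ler_normD z w'; rewrite Nw' -(@ler_pXn2r _ 2)// ?nnegrE ?addr_ge0//.
rewrite sqrrD !krein_normE /= !ell2_innerDl !innerDr.
rewrite (ell2_innerC w.1 z.1) (ell2_innerC (- w.2) z.2) !innerNr.
rewrite (ell2_innerC (- w.2)) innerNr /krein_inner.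
by rewrite mulr2n; lra.
Qed.

Lemma krein_inner_norm z w : `|krein_inner z w| <= `|z| * `|w|.
Proof.
rewrite ler_norml krein_inner_le andbT lerNl -krein_innerNl.
by rewrite (le_trans (krein_inner_le _ _))// normrN.
Qed.

Section orthogonal.
Variables Qp Qm : {linear ell2 R -> ell2 R}.
Hypotheses (oQp : orthogonal_transform Qp) (oQm : orthogonal_transform Qm).

Lemma oplusB z w : oplus Qp Qm (z - w) = oplus Qp Qm z - oplus Qp Qm w.
Proof. by rewrite /oplus /= !linearB. Qed.

Lemma krein_inner_oplus z w :
  krein_inner (oplus Qp Qm z) (oplus Qp Qm w) = krein_inner z w.
Proof. by rewrite /krein_inner /oplus /= oQp.1 oQm.1. Qed.

Lemma norm_oplus z : `|oplus Qp Qm z| = `|z|.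
Proof.
apply/eqP; rewrite -(@eqrXn2 _ 2)//; apply/eqP.
by rewrite !krein_normE /= oQp.1 oQm.1.
Qed.

End orthogonal.
End krein_geometry.

(** * Separability: finitely supported rational sequences are dense *)

Section krein_separable.
Variable R : realType.
Local Notation K := (krein R).

Lemma finite_support_summable (x : nat -> R) N :
  (forall j, (N <= j)%N -> x j = 0) -> x \in @square_summable R.
Proof.
move=> x0; apply/asboolP; apply: (cvgP (series (fun j => x j ^+ 2) N)).
apply: cvg_near_cst; near=> n.
have Nn : (N <= n)%N by near: n; exact: nbhs_infty_ge.
rewrite /series /= (big_cat_nat _ Nn)//= [X in _ + X]big_nat_cond.
rewrite [X in _ + X]big1 ?addr0// => j; rewrite andbT => /andP[Nj _].
by rewrite x0// expr0n.
Unshelve. all: by end_near. Qed.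

Let rat_seq0 (s : seq rat) j : (size s <= j)%N -> ratr (nth 0 s j) = 0 :> R.
Proof. by move=> sj; rewrite nth_default// rmorph0. Qed.

Definition ell2_of_rats (s : seq rat) : ell2 R :=
  Ell2 (finite_support_summable (@rat_seq0 s)).

(** Cut [x] where the tail of its squares is below e^2 / 4, then approximate the remaining
    coordinates so that their squared errors sum to at most e^2 / 4; the total e^2 / 2 is below
    e^2. *)
Lemma ell2_of_rats_dense (x : ell2 R) (e : R) : 0 < e ->
  exists s, ell2_norm (x - ell2_of_rats s) < e.
Proof.
move=> e0; pose u j := x j ^+ 2; pose l := limn (series u).
have cu : cvgn (series u) by exact: is_cvg_ell2_sqr.
have e4 : 0 < e ^+ 2 / 4 by rewrite divr_gt0// exprn_gt0.
have nd : nondecreasing_seq (series u).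
  by apply: nondecreasing_series => j _ _; exact: sqr_ge0.
have [N lN] : exists N, l < series u N + e ^+ 2 / 4.
  have /cvgrPdist_lt/(_ _ e4)[N _ /(_ N (leqnn N))] := cu.
  rewrite -/l ger0_norm ?subr_ge0; last exact: nondecreasing_cvgn_le.
  by rewrite ltrBlDl; exists N.
(* This makes N t^2 at most e^2 / 4; the successor keeps the divisor nonzero when N = 0. *)
pose t := e / (2 * N.+1%:R).
have t0 : 0 < t by rewrite divr_gt0// mulr_gt0.
have /choice[q qx] : forall j, exists q : rat, `|x j - ratr q| < t.
  move=> j; have [|q] := @rat_in_itvoo R (x j - t) (x j + t).
    by rewrite ltrBlDr -addrA ltrDl addr_gt0.
  rewrite in_itv /= => /andP[q1 q2]; exists q.
  by rewrite ltr_norml; apply/andP; split; lra.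
exists (mkseq q N); set s := ell2_of_rats _.
have sj j : s j = if (j < N)%N then ratr (q j) else 0.
  rewrite [s j]/(ratr (nth 0 (mkseq q N) j)).
  case: ltnP => jN; first by rewrite nth_mkseq.
  by apply: rat_seq0; rewrite size_mkseq.
clearbody s.
rewrite -(@ltr_pXn2r _ 2)// ?nnegrE ?sqrtr_ge0 ?ltW// ell2_normE.
have Nt : N%:R * t ^+ 2 <= e ^+ 2 / 4.
  rewrite /t expr_div_n exprMn.
  have N1 : (0 : R) < N.+1%:R by [].
  rewrite mulrA ler_pdivrMr; last by rewrite mulr_gt0 ?exprn_gt0.
  have : N%:R <= N.+1%:R ^+ 2 :> R.
    by rewrite -natrX ler_nat -mulnn (leq_trans (leqnSn _))// leq_pmulr.
  by have := exprn_gt0 2 e0; nra.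
apply: (@le_lt_trans _ _ (e ^+ 2 / 4 + e ^+ 2 / 4)); last by lra.
apply: limr_le; first exact: is_cvg_ell2_inner.
near=> n.
have Nn : (N <= n)%N by near: n; exact: nbhs_infty_ge.
rewrite [leLHS](_ : _ = \sum_(0 <= j < n) (x j - s j) ^+ 2)//.
rewrite (big_cat_nat _ Nn)//= lerD//.
  apply: le_trans Nt; rewrite big_mkord.
  apply: (@le_trans _ _ (\sum_(j < N) t ^+ 2)).
    apply: ler_sum => j _; rewrite sj ltn_ord -real_normK ?num_real//.
    by rewrite ler_pXn2r ?nnegrE// ltW.
  by rewrite sumr_const card_ord mulr_natl.
apply: (@le_trans _ _ (series u n - series u N)).
  rewrite /series /= [X in _ <= X - _](big_cat_nat _ Nn)//= addrAC subrr add0r.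
  rewrite big_nat_cond [leRHS]big_nat_cond; apply: ler_sum => j /andP[/andP[Nj _] _].
  by rewrite sj ltnNge Nj /= subr0.
have := nondecreasing_cvgn_le nd cu n; rewrite -/l; lra.
Unshelve. all: by end_near. Qed.

Definition krein_of_rats (s : seq rat * seq rat) : K :=
  (ell2_of_rats s.1, ell2_of_rats s.2).

Lemma krein_separable : exists d : nat -> K,
  forall (z : K) (e : R), 0 < e -> exists n, `|z - d n| < e.
Proof.
exists (fun n => krein_of_rats (odflt ([::], [::]) (unpickle n))) => z e e0.
have e2 : 0 < e / 2 by rewrite divr_gt0.
have [s1 h1] := ell2_of_rats_dense z.1 e2.
have [s2 h2] := ell2_of_rats_dense z.2 e2.
exists (pickle (s1, s2)); rewrite pickleK /=.
rewrite [`|_|]/(krein_norm _) /krein_norm /=.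
rewrite -(@ltr_pXn2r _ 2)// ?nnegrE ?sqrtr_ge0 ?ltW//.
rewrite sqr_sqrtr ?addr_ge0 ?sqr_ge0//.
have sq a : 0 <= a -> a < e / 2 -> a ^+ 2 < e ^+ 2 / 4.
  by move=> a0 ae; nra.
have := sq _ (sqrtr_ge0 _) h1; have := sq _ (sqrtr_ge0 _) h2.
have : 0 < e ^+ 2 by rewrite exprn_gt0.
move: (_ ^+ 2) (ell2_norm _ ^+ 2) (ell2_norm _ ^+ 2) => *; lra.
Qed.

End krein_separable.

Section krein_measurable.
Variable R : realType.
Local Notation K := (krein R).

Lemma measurable_lipschitz (f : K -> R) :
  (forall z w, `|f z - f w| <= `|z - w|) -> measurable_fun setT f.
Proof.
move=> fL.
apply: (measurability _ (RGenOInfty.measurableE R)) => _ [_ [r ->] <-].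
suff opf : open (f @^-1` `]r, +oo[%classic).
  by rewrite setTI; exact: sub_sigma_algebra.
rewrite openE => z /=.
rewrite in_itv/= andbT => rz; apply/nbhs_ballP; exists (f z - r).
  by rewrite /= subr_gt0.
move=> w; rewrite -ball_normE /= in_itv/= andbT => zw.
have := le_lt_trans (fL z w) zw; rewrite ltr_norml => /andP[_]; lra.
Qed.

(** The product sigma-algebra only gives direct access to functions of one coordinate. Inserting a
    point [d n] of a countable dense set writes the sublevel set as a countable union of conditions
    on sums of such functions. *)
Lemma measurable_dist_oplus (Qp Qm : {linear ell2 R -> ell2 R}) :
  orthogonal_transform Qp -> orthogonal_transform Qm ->
  measurable_fun setT (fun p : K * K => `|p.1 - oplus Qp Qm p.2|).
Proof.
move=> oQp oQm; have [d dP] := krein_separable R.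
have m1 n : measurable_fun setT (fun z : K => `|z - d n|).
  apply: measurable_lipschitz => z w.
  by rewrite (le_trans (ler_dist_dist _ _))// opprB addrA subrK.
have m2 n : measurable_fun setT (fun z : K => `|d n - oplus Qp Qm z|).
  apply: measurable_lipschitz => z w.
  rewrite (le_trans (ler_dist_dist _ _))// opprB addrC addrA subrK.
  by rewrite -oplusB norm_oplus// distrC.
apply: (measurability _ (RGenInftyO.measurableE R)) => _ [_ [r ->] <-].
rewrite setTI (_ : _ @^-1` _ = \bigcup_n
  [set p : K * K | `|p.1 - d n| + `|d n - oplus Qp Qm p.2| < r]).
  apply: bigcup_measurable => n _.
  have : measurable_fun setT
      (fun p : K * K => `|p.1 - d n| + `|d n - oplus Qp Qm p.2|).
    apply: measurable_funD; first exact: (measurableT_comp (m1 n)).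
    exact: (measurableT_comp (m2 n)).
  move=> /(_ measurableT `]-oo, r[%classic (measurable_itv _)).
  by rewrite setTI; congr measurable; apply/seteqP; split => p /=; rewrite in_itv.
apply/seteqP; split => [p|p [n _]] /=; rewrite in_itv/=.
  (* A detour through [d n] costs at most twice the distance from [p.1] to [d n], hence half of the
     slack. *)
  move=> pr; have e0 : 0 < (r - `|p.1 - oplus Qp Qm p.2|) / 2.
    by rewrite divr_gt0 ?subr_gt0.
  have [n dn] := dP p.1 _ e0; exists n => //=.
  have := ler_distD p.1 (d n) (oplus Qp Qm p.2).
  rewrite (distrC (d n) p.1); move: dn pr.
  move: `|p.1 - d n| `|d n - _| `|p.1 - _| => a b c; lra.
exact/le_lt_trans/ler_distD.
Qed.

(** [c z] is the first index of a dense sequence within [e] of [z]; each cell is a ball minus the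
    finitely many earlier balls, hence measurable. *)
Lemma krein_quantizer (e : R) : 0 < e ->
  exists2 c : K -> nat, measurable_fun setT c &
    exists d : nat -> K, forall z, `|z - d (c z)| < e.
Proof.
move=> e0; have [d dP] := krein_separable R.
pose c z := ex_minn (dP z e e0).
exists c; last by exists d => z; rewrite /c; case: ex_minnP.
have mB n : measurable [set z : K | `|z - d n| < e].
  have : measurable_fun setT (fun z : K => `|z - d n|).
    apply: measurable_lipschitz => z w.
    by rewrite (le_trans (ler_dist_dist _ _))// opprB addrA subrK.
  move=> /(_ measurableT `]-oo, e[%classic (measurable_itv _)).
  by rewrite setTI; congr measurable; apply/seteqP; split => p /=; rewrite in_itv.
apply: measurable_fun_nat_valued => n.
rewrite (_ : _ @^-1` _ = [set z | `|z - d n| < e] `\`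
    \bigcup_(m in `I_n) [set z | `|z - d m| < e]).
  by apply: measurableD => //; apply: bigcup_measurable.
apply/seteqP; split => z /=; rewrite /c; case: ex_minnP => m zm mmin.
  by move=> <-; split => // -[k /= km] /mmin; rewrite leqNgt km.
move=> [zn nU]; apply/eqP; rewrite eqn_leq mmin//= leqNgt; apply/negP => mn.
by apply: nU; exists m; [exact: mn|exact: zm].
Qed.

End krein_measurable.

(** * Realizing couplings on the unit interval *)

Section couple.
Variable R : realType.
Local Notation K := (krein R).
Local Notation mR := (measurableTypeR R).
Local Notation U := (@uniform01 R).
Local Notation cc01 := (`[(0 : R), (1 : R)]%classic).

(* [measure_preserving01] demands values in [0, 1] at every point, whereas a law
   only controls them almost surely. *)
Definition clamp01 (x : R) : R := Num.max 0 (Num.min 1 x).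

Lemma clamp01_itv x : cc01 (clamp01 x).
Proof. by rewrite /= in_itv/= /clamp01 le_max lexx ge_max ler01 ge_min lexx. Qed.

Lemma clamp01_id x : 0 < x < 1 -> clamp01 x = x.
Proof.
by move=> /andP[x0 x1]; rewrite /clamp01 min_r ?max_r// ltW.
Qed.

Lemma measurable_clamp01 : measurable_fun setT (clamp01 : mR -> mR).
Proof. by apply: measurable_maxr => //; exact: measurable_minr. Qed.

Lemma uniform01_clamp01 (A : set R) : U (clamp01 @^-1` A) = U A.
Proof. by apply: uniform01_eq => u u01; rewrite /preimage /= clamp01_id. Qed.

(** As [h] has the uniform law, it lies in ]0, 1[ almost surely, where clamping changes nothing. *)
Lemma measure_preserving01_clamp (h : mR -> mR) : measurable_fun setT h ->
  (forall A, measurable A -> U (h @^-1` A) = U A) ->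
  measure_preserving01 (clamp01 \o h).
Proof.
move=> mh hE; have mch : measurable_fun setT (clamp01 \o h).
  exact: measurableT_comp measurable_clamp01 mh.
split; [exact: measurable_funTS|by move=> s _; exact: clamp01_itv|].
move=> A mA Acc; have mhA : measurable ((clamp01 \o h) @^-1` A).
  exact: measurable_preimageT.
have /= -> := @lebesgue_measure_cc01 R _ (measurableI _ _ (measurable_itv _) mhA).
have := @lebesgue_measure_cc01 R A; rewrite setIidr// => ->//.
rewrite comp_preimage hE ?uniform01_clamp01//.
exact: measurable_preimageT measurable_clamp01 mA.
Qed.

(** Clamping the argument makes a sampling map measurable on the whole line and leaves its law
    unchanged. *)
Lemma its_clamp (F : probability K R) (Z : R -> K) :
  inverse_transform_sampling F Z ->
  measurable_fun setT (Z \o clamp01 : mR -> K) /\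
  forall A, measurable A -> U ((Z \o clamp01) @^-1` A) = F A.
Proof.
move=> [mZ ZE]; split.
  apply: (measurable_comp (measurable_itv _) _ mZ measurable_clamp01).
  by move=> _ [x _ <-]; exact: clamp01_itv.
move=> A mA; rewrite comp_preimage uniform01_clamp01 -ZE//.
by apply/esym/lebesgue_measure_cc01; apply: mZ.
Qed.

Variables (F1 F2 : probability K R) (Z1 Z2 : R -> K).
Hypotheses (its1 : inverse_transform_sampling F1 Z1).
Hypotheses (its2 : inverse_transform_sampling F2 Z2).
Variable nu : probability (K * K)%type R.
Hypothesis nuP : couplings F1 F2 nu.
Variables Qp Qm : {linear ell2 R -> ell2 R}.
Hypotheses (oQp : orthogonal_transform Qp) (oQm : orthogonal_transform Qm).

Let f (p : K * K) := `|p.1 - oplus Qp Qm p.2|.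

Let Y1 : mR -> K := Z1 \o clamp01.
Let Y2 : mR -> K := Z2 \o clamp01.

(** Replacing two points by the centres of their cells changes the cost by at most 2 e. This is done
    once on the unit interval and once under [nu], hence 4 e. *)
Lemma coupling_realization (e : R) : 0 < e -> exists h1 h2 : mR -> mR,
  [/\ measurable_fun setT h1 /\ measurable_fun setT h2,
      (forall A, measurable A -> U (h1 @^-1` A) = U A),
      (forall A, measurable A -> U (h2 @^-1` A) = U A) &
      (\int[U]_s (f (Y1 (h1 s), Y2 (h2 s)))%:E <=
       'E_nu[f] + (4 * e)%:E)%E].
Proof.
move=> e0; have [mY1 Y1E] := its_clamp its1; have [mY2 Y2E] := its_clamp its2.
have [q mq [d qd]] := krein_quantizer e0.
pose code (p : K * K) : nat := pickle (q p.1, q p.2).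
have mcode : measurable_fun setT code.
  apply: (measurableT_comp (f := fun ij : nat * nat => pickle ij)).
    by move=> _ A _; rewrite setTI; apply: measurable_nat_prod.
  by apply: measurable_fun_pair; apply: measurableT_comp.
pose P : probability nat R := distribution nu (mfun_of mcode).
have [T mT TE] := uniform01_nat_prod P.
pose dec n : nat * nat := odflt (0%N, 0%N) (unpickle n).
have decK p : dec (code p) = (q p.1, q p.2) by rewrite /dec /code pickleK.
have mqn n : measurable (q @^-1` [set n]) by exact: measurable_preimageT.
(* The marginals of [nu] are the laws of [Y1] and [Y2], so each decoded cell index has the law
   required by [measure_preserving_lift]. *)
have P1 n : P ((fun n => (dec n).1) @^-1` [set n]) = U ((q \o Y1) @^-1` [set n]).
  rewrite comp_preimage Y1E// -nuP.1//; congr (nu _).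
  by apply/seteqP; split => p /=; rewrite decK.
have P2 n : P ((fun n => (dec n).2) @^-1` [set n]) = U ((q \o Y2) @^-1` [set n]).
  rewrite comp_preimage Y2E// -nuP.2//; congr (nu _).
  by apply/seteqP; split => p /=; rewrite decK.
have [h1 [mh1 h1E h1n]] :=
  measure_preserving_lift mT TE (measurableT_comp mq mY1) P1.
have [h2 [mh2 h2E h2n]] :=
  measure_preserving_lift mT TE (measurableT_comp mq mY2) P2.
exists h1, h2; split => //.
have f0 p : 0 <= f p by exact: normr_ge0.
have mf : measurable_fun setT f := measurable_dist_oplus oQp oQm.
pose g (ij : nat * nat) := `|d ij.1 - oplus Qp Qm (d ij.2)|.
have fg z w : `|f (z, w) - g (q z, q w)| <= 2 * e.
  rewrite /f /g /= (le_trans (ler_dist_dist _ _))//.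
  rewrite opprB [X in _ + X]addrC addrACA [X in _ + X]addrC -oplusB.
  rewrite mulr_natl mulr2n.
  apply: (le_trans (ler_normD _ _)); apply: lerD.
    exact/ltW/qd.
  by rewrite norm_oplus// distrC; exact/ltW/qd.
(* The cost between cell centres, raised by 2 e so as to dominate [f] on the pair of cells coded by
   n. *)
pose G n := (g (dec n) + 2 * e)%:E.
have G0 n : (0 <= G n)%E.
  rewrite lee_fin; apply: addr_ge0; first exact: normr_ge0.
  by rewrite mulr_ge0// ltW.
have mG : measurable_fun setT G by [].
have mTfst : measurable_fun setT (fst \o T) by exact: measurableT_comp.
have kP n : U ((fst \o T) @^-1` [set n]) = P [set n].
  have mn : measurable ([set n] `*` [set: mR]) by exact: measurableX.
  have := TE _ mn.
  rewrite product_measure1E// [X in (_ * X)%E]uniform01_setT mule1 => <-.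
  by congr (U _); apply/seteqP; split => s //= [].
(* Outside two null sets, [Y1 (h1 s)] and [Y2 (h2 s)] lie in the cells coded by [(T s).1]. *)
apply: (@le_trans _ _ (\int[U]_s G (T s).1)%E).
  apply: ae_ge0_le_integral => //.
  - by move=> s _; rewrite lee_fin f0.
  - apply/measurable_EFinP; apply: (measurableT_comp mf).
    by apply: measurable_fun_pair; exact: measurableT_comp.
  - exact: (measurableT_comp mG mTfst).
  have mne (a b : mR -> nat) : measurable_fun setT a -> measurable_fun setT b ->
      measurable [set s | a s != b s].
    move=> ma mb.
    have := measurable_fun_pair ma mb.
    move=> /(_ measurableT [set ij | ij.1 != ij.2]); rewrite setTI; apply.
    exact: measurable_nat_prod.
  have mN1 := mne _ _ (measurableT_comp (measurableT_comp mq mY1) mh1)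
    (measurableT_comp (f := fun n => (dec n).1) (fun _ _ _ => I) mTfst).
  have mN2 := mne _ _ (measurableT_comp (measurableT_comp mq mY2) mh2)
    (measurableT_comp (f := fun n => (dec n).2) (fun _ _ _ => I) mTfst).
  eexists; split; first exact: (measurableU _ _ mN1 mN2).
    by rewrite measureU0//; exact: h1n.
  rewrite -[X in _ `<=` X]setCK; apply: subsetC; rewrite setCU => s [/negP/negPn/eqP + /negP/negPn/eqP].
  rewrite /= => e1 e2 _; rewrite lee_fin.
  have := fg (Y1 (h1 s)) (Y2 (h2 s)); rewrite e1 e2 -surjective_pairing.
  by rewrite ler_norml => /andP[_]; rewrite lerBlDl.
(* In fact an equality: [(T s).1] under [U] and [code] under [nu] both have the law [P]. *)
apply: (@le_trans _ _ (\int[nu]_p G (code p))%E).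
  rewrite (ge0_integral_nat_valued U (c := fst \o T) mTfst G0).
  rewrite (ge0_integral_nat_valued nu mcode G0).
  rewrite le_eqVlt; apply/orP; left; apply/eqP.
  apply: eq_eseriesr => n _; congr (_ * _)%E.
  exact: kP.
have -> : (4 * e)%:E = (\int[nu]_p (4 * e)%:E)%E.
  by rewrite integral_cst// [X in (_ * X)%E]probability_setT mule1.
rewrite unlock -ge0_integralD//; first last.
- by move=> p _; rewrite lee_fin mulr_ge0// ltW.
- exact/measurable_EFinP.
- by move=> p _; rewrite lee_fin f0.
apply: ge0_le_integral => //.
- exact: (measurableT_comp mG mcode).
- by apply: emeasurable_funD => //; exact/measurable_EFinP.
move=> [z w] _; rewrite /G decK -EFinD lee_fin.
by have := fg z w; rewrite ler_norml => /andP[+ _]; rewrite /f /=; lra.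
Qed.

End couple.

(** * Bounding the cut distance *)

(* [g] need not be measurable: the integral of a nonnegative function is then the
   lower one, which is still monotone. *)
Lemma le_abse_integral_dominated d (T : measurableType d) (R : realType)
    (mu : {measure set T -> \bar R}) (D : set T) (g B : T -> \bar R) :
  (forall x, D x -> `|g x| <= B x)%E ->
  (`| \int[mu]_(x in D) g x | <= \int[mu]_(x in D) B x)%E.
Proof.
move=> gB; have B0 x : D x -> (0 <= B x)%E.
  by move=> Dx; exact: le_trans (gB x Dx).
have le_B h : (forall x, D x -> 0 <= h x <= B x)%E ->
    (0 <= \int[mu]_(x in D) h x <= \int[mu]_(x in D) B x)%E.
  move=> hB; have h0 x : D x -> (0 <= h x)%E by move=> /hB/andP[].
  rewrite integral_ge0//= ge0_integralE// [leRHS]ge0_integralE//.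
  apply: ereal_sup_le => _ [s sh <-]; exists s => // x; rewrite (le_trans (sh x))// !patchE; case: ifPn => // xD.
  by have /andP[] := hB x (set_mem xD).
have /andP[p0 pB] : (0 <= \int[mu]_(x in D) g^\+ x <= \int[mu]_(x in D) B x)%E.
  apply: le_B => x Dx; rewrite funepos_ge0 (le_trans _ (gB x Dx))//.
  by rewrite -/((abse \o g) x) fune_abse leeDl// funeneg_ge0.
have /andP[n0 nB] : (0 <= \int[mu]_(x in D) g^\- x <= \int[mu]_(x in D) B x)%E.
  apply: le_B => x Dx; rewrite funeneg_ge0 (le_trans _ (gB x Dx))//.
  by rewrite -/((abse \o g) x) fune_abse leeDr// funepos_ge0.
rewrite integralE; move: p0 pB n0 nB.
move: (\int[mu]_(x in D) g^\+ x)%E (\int[mu]_(x in D) g^\- x)%E => [p||] [n||] //=.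
case: (\int[mu]_(x in D) B x)%E => [b||] //=; rewrite ?leey// !lee_fin => *.
by rewrite ler_norml; apply/andP; split; lra.
Qed.

Lemma ge0_integral_prod d1 d2 (T1 : measurableType d1) (T2 : measurableType d2)
    (R : realType) (m1 : {sigma_finite_measure set T1 -> \bar R})
    (m2 : {sigma_finite_measure set T2 -> \bar R})
    (f : T1 -> \bar R) (g : T2 -> \bar R) :
  measurable_fun setT f -> measurable_fun setT g ->
  (forall x, 0 <= f x)%E -> (forall y, 0 <= g y)%E ->
  (\int[m1 \x m2]_p (f p.1 * g p.2) = (\int[m1]_x f x) * (\int[m2]_y g y))%E.
Proof.
move=> mf mg f0 g0; rewrite fubini_tonelli1; first last.
- by move=> p; rewrite mule_ge0.
- by apply: emeasurable_funM; apply: measurableT_comp.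
rewrite -ge0_integralZr//; last by apply: integral_ge0.
by apply: eq_integral => x _; rewrite /fubini_F /= ge0_integralZl.
Qed.

Lemma integral_cc01_le (R : realType) (f : R -> \bar R) :
  measurable_fun setT f -> (forall x, 0 <= f x)%E ->
  (\int[@lebesgue_measure R]_(s in `[(0%R : R), (1%R : R)]%classic) f s <=
   \int[@uniform01 R]_s f s)%E.
Proof.
move=> mf f0; rewrite (@eq_measure_integral _ _ _ _ (@uniform01 R)).
  by apply: ge0_subset_integral => //; exact: measurable_itv.
move=> A mA Acc; have := @lebesgue_measure_cc01 _ A.
by rewrite setIidr//; exact.
Qed.

(** * Mean norms and the cost of a coupling *)

Section mean_norm.
Variable R : realType.
Local Notation K := (krein R).

Lemma measurable_krein_norm : measurable_fun setT (fun z : K => `|z|).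
Proof. by apply: measurable_lipschitz => z w; exact: ler_dist_dist. Qed.

(** Change of variables, used both for the sampled variables on the unit interval and for the two
    coordinates under a coupling. *)
Lemma mean_normE d (T : measurableType d) (P : probability T R) (X : T -> K)
    (F : probability K R) : measurable_fun setT X ->
  (forall A, measurable A -> P (X @^-1` A) = F A) ->
  (\int[P]_t `|X t|%:E = 'E_F[fun z : K => `|z|%R])%E.
Proof.
move=> mX XE; rewrite unlock.
rewrite (@eq_measure_integral _ _ _ _ (distribution P (mfun_of mX))); last first.
  by move=> A mA _; exact/esym/XE.
rewrite ge0_integral_distribution//.
by apply/measurable_EFinP; exact: measurable_krein_norm.
Qed.

Lemma mean_norm_ge0 (F : probability K R) : (0 <= 'E_F[fun z : K => `|z|%R])%E.
Proof. by rewrite unlock integral_ge0// => z _; rewrite lee_fin. Qed.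

Let le_1Dsqr (t : R) : t <= 1 + t ^+ 2.
Proof. by have := sqr_ge0 (t - 1); have := sqr_ge0 t; nra. Qed.

(** Integrate t <= 1 + t^2 against a law of total mass 1. *)
Lemma mean_norm_fin_num (F : probability K R) : square_integrable F ->
  ('E_F[fun z : K => `|z|%R])%E \is a fin_num.
Proof.
rewrite /square_integrable => F2; rewrite ge0_fin_numE ?mean_norm_ge0//.
apply: (@le_lt_trans _ _ (1 + 'E_F[fun z : K => (`|z| ^+ 2)%R])%E); last first.
  by rewrite lte_add_pinfty// ltry.
have mn : measurable_fun setT (fun z : K => `|z|%:E).
  by apply/measurable_EFinP; exact: measurable_krein_norm.
have mn2 : measurable_fun setT (fun z : K => (`|z| ^+ 2)%:E).
  by apply/measurable_EFinP; apply: measurable_funX; exact: measurable_krein_norm.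
have n20 z : [set: K] z -> (0 <= (`|z| ^+ 2)%:E)%E.
  by rewrite lee_fin exprn_ge0.
have -> : 1%E = (\int[F]_z (1%:E))%E.
  by rewrite integral_cst// [X in (_ * X)%E]probability_setT mule1.
rewrite unlock -ge0_integralD//.
apply: ge0_le_integral => //; first exact: emeasurable_funD.
move=> z _; rewrite -EFinD lee_fin.
exact: le_1Dsqr.
Qed.

Section coupling_bounds.
Variables (F1 F2 : probability K R) (nu : probability (K * K)%type R).
Hypothesis nuP : couplings F1 F2 nu.
Variables Qp Qm : {linear ell2 R -> ell2 R}.
Hypotheses (oQp : orthogonal_transform Qp) (oQm : orthogonal_transform Qm).
Let f (p : K * K) := `|p.1 - oplus Qp Qm p.2|.

Let mf : measurable_fun setT f := measurable_dist_oplus oQp oQm.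

Let mfst : measurable_fun setT (fun p : K * K => `|p.1|%:E).
Proof.
by apply/measurable_EFinP; exact: (measurableT_comp measurable_krein_norm).
Qed.

Let msnd : measurable_fun setT (fun p : K * K => `|p.2|%:E).
Proof.
by apply/measurable_EFinP; exact: (measurableT_comp measurable_krein_norm).
Qed.

(** Triangle inequality, the transform being isometric. With finite mean norms the cost is finite,
    which lets the quantization error tend to 0 later. *)
Lemma coupling_cost_le :
  ('E_nu[f] <= 'E_F1[fun z : K => `|z|%R] + 'E_F2[fun z : K => `|z|%R])%E.
Proof.
rewrite -(mean_normE measurable_fst nuP.1) -(mean_normE measurable_snd nuP.2).
rewrite unlock -ge0_integralD//; try by move=> p _; rewrite lee_fin.
apply: ge0_le_integral => //.
- by move=> p _; rewrite lee_fin normr_ge0.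
- exact/measurable_EFinP.
- exact: emeasurable_funD.
move=> p _; rewrite -EFinD lee_fin (le_trans (ler_normB _ _))//.
by rewrite norm_oplus.
Qed.

Lemma mean_norm_le_coupling_cost :
  ('E_F1[fun z : K => `|z|%R] <= 'E_nu[f] + 'E_F2[fun z : K => `|z|%R])%E.
Proof.
rewrite -(mean_normE measurable_fst nuP.1) -(mean_normE measurable_snd nuP.2).
have f0 p : [set: K * K] p -> (0 <= (f p)%:E)%E by rewrite lee_fin normr_ge0.
have mfE : measurable_fun setT (EFin \o f) by exact/measurable_EFinP.
rewrite unlock -ge0_integralD//.
apply: ge0_le_integral => //; first exact: emeasurable_funD.
move=> p _; rewrite -EFinD lee_fin -(norm_oplus oQp oQm p.2).
by rewrite -lerBlDr lerB_dist.
Qed.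

End coupling_bounds.
End mean_norm.

Section cut_distance_bound.
Variable R : realType.
Local Notation K := (krein R).
Local Notation mR := (measurableTypeR R).
Local Notation U := (@uniform01 R).
Local Notation mu := (@lebesgue_measure R).
Local Notation cc01 := (`[(0 : R), (1 : R)]%classic).

(** The dominating function is a sum of products of one-variable functions, so by Tonelli its
    integral factors. It is applied with [a] the distance of the two sampled points after the
    transform, and [b], [c] their norms. *)
Lemma cut_norm_le (D : R -> R -> R) (a b c : mR -> R) :
  measurable_fun setT a -> measurable_fun setT b -> measurable_fun setT c ->
  (forall s, 0 <= a s) -> (forall s, 0 <= b s) -> (forall s, 0 <= c s) ->
  (forall s t, cc01 s -> cc01 t -> `|D s t| <= a s * b t + c s * a t) ->
  (cut_norm D <= (\int[U]_s (b s)%:E + \int[U]_s (c s)%:E) *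
    \int[U]_s (a s)%:E)%E.
Proof.
move=> ma mb mc a0 b0 c0 Dabc; apply: ge_ereal_sup => _ [[S T] /= [mS S01 mT T01] <-].
have mcc : measurable (cc01 : set mR) by exact: measurable_itv.
(* Extension by 0 off [0, 1] allows [S] x [T] to be enlarged to the whole plane. *)
pose ext (g : mR -> R) : mR -> \bar R := (EFin \o g) \_ cc01.
have mext (g : mR -> R) : measurable_fun setT g -> measurable_fun setT (ext g).
  move=> mg; have mEg : measurable_fun setT (EFin \o g) by exact/measurable_EFinP.
  by have [+ _] := measurable_restrictT (EFin \o g) mcc; apply; exact: measurable_funTS.
have ext0 (g : mR -> R) : (forall s, 0 <= g s) -> forall s, (0 <= ext g s)%E.
  by move=> g0 s; rewrite /ext patchE; case: ifPn => // _; rewrite lee_fin.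
have extE g s : cc01 s -> ext g s = (g s)%:E.
  by move=> s01; rewrite /ext patchE mem_set.
have int_ext (g : mR -> R) : measurable_fun setT g -> (forall s, 0 <= g s) ->
    (\int[mu]_s ext g s <= \int[U]_s (g s)%:E)%E.
  move=> mg g0; rewrite /ext -integral_mkcond; apply: integral_cc01_le => //.
  exact/measurable_EFinP.
have ia0 (g : mR -> R) : (forall s, 0 <= g s) -> (0 <= \int[mu]_s ext g s)%E.
  by move=> g0; apply: integral_ge0 => s _; exact: ext0.
pose B p := (ext a p.1 * ext b p.2 + ext c p.1 * ext a p.2)%E.
have mp (g h : mR -> R) : measurable_fun setT g -> measurable_fun setT h ->
    measurable_fun setT (fun p : mR * mR => (ext g p.1 * ext h p.2)%E).
  move=> mg mh; apply: emeasurable_funM.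
    exact: (measurableT_comp (mext _ mg)).
  exact: (measurableT_comp (mext _ mh)).
have B0 p : (0 <= B p)%E by rewrite /B adde_ge0// mule_ge0// ext0.
apply: (@le_trans _ _ (\int[mu \x mu]_(p in S `*` T) B p)%E).
  apply: le_abse_integral_dominated => -[s t] [/= /S01 s01 /T01 t01].
  by rewrite /B /= !extE//= lee_fin Dabc.
apply: (@le_trans _ _ (\int[mu \x mu]_p B p)%E).
  apply: ge0_subset_integral => //; first exact: measurableX.
  by apply: emeasurable_funD; exact: mp.
rewrite /B ge0_integralD//; first last.
- exact: mp.
- by move=> p _; rewrite mule_ge0// ext0.
- exact: mp.
- by move=> p _; rewrite mule_ge0// ext0.
rewrite !ge0_integral_prod; try by [exact: mext|exact: ext0].
rewrite [leRHS]ge0_muleDl; try by apply: integral_ge0 => s _; rewrite lee_fin.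
by apply: leeD; [rewrite muleC|]; apply: lee_pmul; rewrite ?ia0//; exact: int_ext.
Qed.

(** Each cut norm is a supremum of absolute values over a family that contains the pair of empty
    sets. *)
Lemma cut_distance_ge0 (W1 W2 : R -> R -> R) : (0 <= cut_distance W1 W2)%E.
Proof.
apply: le_ereal_inf_tmp => _ [h _ <-].
rewrite /cut_norm; set I := (X in ereal_sup X).
have [x Ix x0] : exists2 x, I x & (0 <= x)%E.
  eexists; first by exists (set0, set0); [split => //= ? []|reflexivity].
  exact: abse_ge0.
exact: le_trans x0 (ereal_sup_ubound Ix).
Qed.

Section coupling.
Variables (F1 F2 : probability K R) (W1 W2 : R -> R -> R).
Hypotheses (F1W1 : graphon_of F1 W1) (F2W2 : graphon_of F2 W2).
Variable nu : probability (K * K)%type R.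
Hypothesis nuP : couplings F1 F2 nu.
Variables Qp Qm : {linear ell2 R -> ell2 R}.
Hypotheses (oQp : orthogonal_transform Qp) (oQm : orthogonal_transform Qm).
Let f (p : K * K) := `|p.1 - oplus Qp Qm p.2|.

Lemma cut_distance_le_coupling_eps (e : R) : 0 < e ->
  (cut_distance W1 W2 <=
    ('E_F1[fun z : K => `|z|%R] + 'E_F2[fun z : K => `|z|%R]) *
    ('E_nu[f] + (4 * e)%:E))%E.
Proof.
move=> e0; have [Z1 its1 W1E] := F1W1; have [Z2 its2 W2E] := F2W2.
have [mY1 Y1E] := its_clamp its1; have [mY2 Y2E] := its_clamp its2.
have [h1 [h2 [[mh1 mh2] h1E h2E cost]]] :=
  coupling_realization its1 its2 nuP oQp oQm e0.
pose X1 := (Z1 \o @clamp01 R) \o h1; pose X2 := (Z2 \o @clamp01 R) \o h2.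
have mX1 : measurable_fun setT X1 by exact: measurableT_comp.
have mX2 : measurable_fun setT X2 by exact: measurableT_comp.
have X1E A : measurable A -> U (X1 @^-1` A) = F1 A.
  move=> mA; rewrite comp_preimage h1E ?Y1E//.
  exact: measurable_preimageT mY1 mA.
have X2E A : measurable A -> U (X2 @^-1` A) = F2 A.
  move=> mA; rewrite comp_preimage h2E ?Y2E//.
  exact: measurable_preimageT mY2 mA.
have mn := @measurable_krein_norm R.
have mf : measurable_fun setT (fun s => f (X1 s, X2 s)).
  apply: (measurableT_comp (measurable_dist_oplus oQp oQm)).
  exact: measurable_fun_pair.
apply: (@le_trans _ _ (cut_norm (fun s t =>
    W1 (clamp01 (h1 s)) (clamp01 (h1 t)) - W2 (clamp01 (h2 s)) (clamp01 (h2 t))))).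
  apply: ereal_inf_lbound; exists (@clamp01 R \o h1, @clamp01 R \o h2) => //.
  by split; exact: measure_preserving01_clamp.
apply: (le_trans (@cut_norm_le _ (fun s => f (X1 s, X2 s))
    (fun s => `|X1 s|) (fun s => `|X2 s|) mf (measurableT_comp mn mX1)
    (measurableT_comp mn mX2) _ _ _ _)) => //.
- by move=> s; exact: normr_ge0.
- move=> s t _ _; rewrite W1E ?W2E; try exact: clamp01_itv.
  rewrite -[Z1 _]/(X1 s) -[Z1 _]/(X1 t) -[Z2 _]/(X2 s) -[Z2 _]/(X2 t).
  (* The graphon [W2] does not see the orthogonal transform, which may thus be applied to both of
     its points. *)
  rewrite -(krein_inner_oplus oQp oQm (X2 s)) /f /=.
  set Y2s := oplus _ _ (X2 s); set Y2t := oplus _ _ (X2 t).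
  rewrite -(norm_oplus oQp oQm (X2 s)) -/Y2s.
  have -> : krein_inner (X1 s) (X1 t) - krein_inner Y2s Y2t =
      krein_inner (X1 s - Y2s) (X1 t) + krein_inner Y2s (X1 t - Y2t).
    rewrite krein_innerDl krein_innerNl (krein_innerC Y2s (_ - _)).
    rewrite krein_innerDl krein_innerNl !(krein_innerC _ Y2s); ring.
  by rewrite (le_trans (ler_normD _ _))// lerD// krein_inner_norm.
rewrite (mean_normE mX1 X1E) (mean_normE mX2 X2E).
by apply: lee_wpmul2l => //; rewrite adde_ge0// mean_norm_ge0.
Qed.

End coupling.
End cut_distance_bound.

(** * Passing to the infimum over couplings and transforms *)

Section orthogonal_wasserstein_bound.
Variable R : realType.
Local Notation K := (krein R).
Local Notation M F := ('E_F[fun z : K => `|z|%R])%E.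

Lemma cut_distance_le_coupling (F1 F2 : probability K R) (W1 W2 : R -> R -> R)
    (nu : probability (K * K)%type R) (Qp Qm : {linear ell2 R -> ell2 R}) :
  square_integrable F1 -> square_integrable F2 ->
  graphon_of F1 W1 -> graphon_of F2 W2 -> couplings F1 F2 nu ->
  orthogonal_transform Qp -> orthogonal_transform Qm ->
  (cut_distance W1 W2 <=
    (M F1 + M F2) * 'E_nu[fun p : K * K => `|p.1 - oplus Qp Qm p.2|%R])%E.
Proof.
move=> /mean_norm_fin_num M1 /mean_norm_fin_num M2 g1 g2 nuP oQp oQm.
have := coupling_cost_le nuP oQp oQm.
have := cut_distance_le_coupling_eps g1 g2 nuP oQp oQm.
have : (0 <= 'E_nu[fun p : K * K => `|p.1 - oplus Qp Qm p.2|%R])%E.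
  by rewrite unlock integral_ge0// => p _; rewrite lee_fin.
have := mean_norm_ge0 F2; have := mean_norm_ge0 F1.
move: M1 M2; move: (M F1) (M F2) => [m1||] [m2||] // _ _.
rewrite -!EFinD !lee_fin => m10 m20.
move: ('E_nu[_])%E => [c||] // c0 cutD _.
apply/lee_addgt0Pr => e e0.
(* Quantizing at radius e / (4 (m1 + m2 + 1)) makes the total error at most e; the added 1 keeps the
   divisor positive when both means vanish. *)
have m0 : 0 < 4 * (m1 + m2 + 1) by rewrite mulr_gt0// ltr_wpDl ?addr_ge0.
have := cutD _ (divr_gt0 e0 m0); move/le_trans; apply.
rewrite -!EFinM -!EFinD lee_fin mulrDr lerD2l.
rewrite mulrA mulrA ler_pdivrMr// [leRHS]mulrA mulrC.
by rewrite -[X in _ <= X]mulrA ler_wpM2l ?ltW//; nra.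
Qed.

Let id2 : {linear ell2 R -> ell2 R} := idfun.

Let orthogonal_id : orthogonal_transform id2.
Proof. by split => // y; exists y. Qed.

(** The independent coupling, which serves the case where both mean norms are 0. *)
Lemma couplings_prod (F1 F2 : probability K R) :
  couplings F1 F2 (F1 \x F2)%E.
Proof.
split => A mA /=.
  rewrite (_ : _ @^-1` _ = A `*` setT); last by apply/seteqP; split => -[x y] //= [].
  by rewrite product_measure1E// [X in (_ * X)%E]probability_setT mule1.
rewrite (_ : _ @^-1` _ = setT `*` A); last by apply/seteqP; split => -[x y] //= [].
by rewrite product_measure1E// [X in (X * _)%E]probability_setT mul1e.
Qed.

Lemma cut_distance_le_orthogonal_wasserstein (F1 F2 : probability K R)
    (W1 W2 : R -> R -> R) :
  square_integrable F1 -> square_integrable F2 ->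
  graphon_of F1 W1 -> graphon_of F2 W2 ->
  (cut_distance W1 W2 <= (M F1 + M F2) * orthogonal_wasserstein F1 F2)%E.
Proof.
move=> s1 s2 g1 g2.
have bound nu (Q : {linear ell2 R -> ell2 R} * {linear ell2 R -> ell2 R}) nuP oQ1 oQ2 :=
  @cut_distance_le_coupling F1 F2 W1 W2 nu Q.1 Q.2 s1 s2 g1 g2 nuP oQ1 oQ2.
have := mean_norm_ge0 F2; have := mean_norm_ge0 F1.
move: bound; move: (mean_norm_fin_num s1) (mean_norm_fin_num s2).
move: (M F1) (M F2) => [m1||] [m2||] // _ _.
rewrite -!EFinD !lee_fin => bound m10 m20.
have := addr_ge0 m10 m20; rewrite le_eqVlt => /predU1P[m0|m0].
  (* When the factor is 0 it cannot be divided out of the infimum, but a single coupling already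
     bounds the cut distance by 0. *)
  have := bound (F1 \x F2)%E (id2, id2) (couplings_prod F1 F2)
    orthogonal_id orthogonal_id.
  by rewrite -m0 !mul0e.
(* Dividing by the positive factor leaves a lower bound to check on every member of both infima. *)
rewrite -lee_pdivrMl//; apply: le_ereal_inf_tmp => _ [nu nuP <-].
apply: le_ereal_inf_tmp => _ [Q [oQ1 oQ2] <-].
by rewrite lee_pdivrMl//; exact: bound.
Qed.

(** Subtracting the finite mean norm of [F2] leaves a lower bound on the cost of every coupling. It
    keeps the mean norms bounded along a convergent sequence. *)
Lemma mean_norm_le_orthogonal_wasserstein (F1 F2 : probability K R) :
  square_integrable F2 -> (M F1 <= orthogonal_wasserstein F1 F2 + M F2)%E.
Proof.
move=> /mean_norm_fin_num M2; rewrite -leeBlDr//.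
apply: le_ereal_inf_tmp => _ [nu nuP <-].
apply: le_ereal_inf_tmp => _ [Q [oQ1 oQ2] <-].
by rewrite leeBlDr//; exact: mean_norm_le_coupling_cost.
Qed.

End orthogonal_wasserstein_bound.

Theorem theorem3p8 (R : realType) :
  (forall (F1 F : probability (krein R) R) (W1 W : R -> R -> R),
     graph_root_distribution F1 -> square_integrable F1 ->
     graph_root_distribution F -> square_integrable F ->
     graphon_of F1 W1 -> graphon_of F W ->
     (cut_distance W1 W <=
       ('E_F1[fun z : krein R => `|z|%R] + 'E_F[fun z : krein R => `|z|%R]) *
       orthogonal_wasserstein F1 F)%E) /\
  (forall (F_ : nat -> probability (krein R) R) (F : probability (krein R) R)
     (W_ : nat -> R -> R -> R) (W : R -> R -> R),
     (forall N, (1 <= N)%N ->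
        [/\ graph_root_distribution (F_ N), square_integrable (F_ N) &
            graphon_of (F_ N) (W_ N)]) ->
     graph_root_distribution F -> square_integrable F -> graphon_of F W ->
     orthogonal_wasserstein (F_ N) F @[N --> \oo] --> 0%E ->
     cut_distance (W_ N) W @[N --> \oo] --> 0%E).
Proof.
split=> [F1 F W1 W _ s1 _ s2 g1 g2|F_ F W_ W F_P _ s g d0].
  exact: cut_distance_le_orthogonal_wasserstein.
pose m := fine ('E_F[fun z : krein R => `|z|%R])%E.
have mE : ('E_F[fun z : krein R => `|z|%R])%E = m%:E.
  by rewrite fineK// mean_norm_fin_num.
have m0 : 0 <= m by rewrite fine_ge0// mean_norm_ge0.
(* Once the distance is below 1, the mean norm of [F_ N] is at most 1 + [m], so the factor in the
   bound is at most 1 + 2 [m]. *)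
apply: (@squeeze_cvge _ _ _ _ (cst 0%E) _
    (fun N => (1 + 2 * m)%:E * orthogonal_wasserstein (F_ N) F)%E).
- near=> N; rewrite cut_distance_ge0/=.
  have [|_ sN gN] := F_P N; first by near: N; exact: nbhs_infty_gt.
  apply: (le_trans (cut_distance_le_orthogonal_wasserstein sN s gN g)).
  have dN1 : (orthogonal_wasserstein (F_ N) F < 1%:E)%E.
    near: N; have /(_ [set x | (x < 1%:E)%E]) := d0; apply.
    exact: (@nbhs_open_ereal_lt _ _ (fun=> 1) ltr01).
  apply: lee_wpmul2r.
    apply: le_ereal_inf_tmp => _ [nu _ <-].
    apply: le_ereal_inf_tmp => _ [Q _ <-].
    by rewrite unlock integral_ge0// => p _; rewrite lee_fin normr_ge0.
  have := mean_norm_le_orthogonal_wasserstein (F_ N) s; rewrite mE => MN.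
  apply: (@le_trans _ _ (1 + m%:E + m%:E)%E).
    apply: leeD => //; apply: (le_trans MN); apply: leeD => //.
    exact: ltW.
  by rewrite -!EFinD lee_fin mulr_natl mulr2n addrA.
- exact: cvg_cst.
- by rewrite -[X in _ --> X](mule0 (1 + 2 * m)%:E); exact: cvgeZl.
Unshelve. all: by end_near. Qed.
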